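(* For every Coxeter system $(W,S)$, the language $\mathcal R(W^{FC})=\bigcup_{w\in W^{FC}}\mathcal R(w)\subseteq S^*$ of all reduced expressions of fully commutative elements is a regular language over the alphabet $S$ (i.e. it is recognized by a finite deterministic automaton).
   Context: Coxeter system $(W,S)$: finite $S$, symmetric $(m_{st})$ with $m_{ss}=1$, $m_{st}\in\{2,3,\dots\}\cup\{\infty\}$ for $s\ne t$, $W=\langle S\mid (st)^{m_{st}}=1,\ m_{st}<\infty\rangle$. $\mathcal R(w)$ is the set of reduced expressions of $w$ (words in $S$ of minimal length representing $w$). $w$ is fully commutative if $\mathcal R(w)$ is a single class for the equivalence on $S^*$ generated by $\mathbf u st\mathbf v\sim\mathbf u ts\mathbf v$ when $m_{st}=2$; $W^{FC}$ is the set of such elements. *)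

(* Defs.v *)
From mathcomp Require Import all_boot.
Set Implicit Arguments. Unset Strict Implicit. Unset Printing Implicit Defensive.

(* A Coxeter matrix on a finite set S of generators, encoded as
   m : S -> S -> nat with the convention  m s t = 0  <->  m_{st} = infinity. *)
Definition coxeter_matrix (S : finType) (m : S -> S -> nat) : Prop :=
  [/\ forall s t, m s t = m t s,
      forall s, m s s = 1
    & forall s t, s != t -> m s t != 1].

Definition relator (S : finType) (m : S -> S -> nat) (s t : S) : seq S :=
  flatten (nseq (m s t) [:: s; t]).

(* One elementary step: insert or delete a relator (s t)^{m_st} (m_st finite)
   anywhere in a word.  Since m_ss = 1 makes every generator an involution,
   the monoid S^* / (this congruence) is exactly the group W. *)
Inductive cox_step (S : finType) (m : S -> S -> nat) : seq S -> seq S -> Prop :=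
| cox_del u v s t : 0 < m s t -> cox_step m (u ++ relator m s t ++ v) (u ++ v)
| cox_ins u v s t : 0 < m s t -> cox_step m (u ++ v) (u ++ relator m s t ++ v).

Inductive cox_eq (S : finType) (m : S -> S -> nat) : seq S -> seq S -> Prop :=
| cox_refl w : cox_eq m w w
| cox_trans u v w : cox_step m u v -> cox_eq m v w -> cox_eq m u w.

Definition reduced (S : finType) (m : S -> S -> nat) (w : seq S) : Prop :=
  forall w', cox_eq m w w' -> size w <= size w'.

Inductive comm_step (S : finType) (m : S -> S -> nat) : seq S -> seq S -> Prop :=
| comm_swap u v s t : m s t = 2 -> comm_step m (u ++ [:: s; t] ++ v) (u ++ [:: t; s] ++ v).

Inductive comm_eq (S : finType) (m : S -> S -> nat) : seq S -> seq S -> Prop :=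
| comm_refl w : comm_eq m w w
| comm_trans u v w : comm_step m u v -> comm_eq m v w -> comm_eq m u w.

(* w is a reduced expression of a fully commutative element: w is reduced and
   every reduced expression of the same element of W is commutation
   equivalent to w (so R(element) is a single commutation class). *)
Definition FC_reduced_word (S : finType) (m : S -> S -> nat) (w : seq S) : Prop :=
  reduced m w /\
  forall w', cox_eq m w w' -> reduced m w' -> comm_eq m w w'.

Definition regular_language (S : finType) (L : seq S -> Prop) : Prop :=
  exists (Q : finType) (q0 : Q) (delta : Q -> S -> Q) (acc : pred Q),
    forall w, L w <-> acc (foldl delta q0 w).

(* Main.v *)
(**
  A word is a reduced expression of a fully commutative element iff no word of its
  commutation class contains a factor [s s] or an alternating factor [s t s ..] of
  length m_st with 3 <= m_st < infinity (Stembridge).  Containing, up to commutations, a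
  factor from a finite set is a regular condition: it suffices to remember the pairs
  (q, V) such that w is commutation equivalent to some u q v with V the set of letters
  of v, because in any word commutation equivalent to w a, the last a commutes with
  everything after it.

  Stembridge's criterion is proved by induction on the length.  The parity of the number
  of occurrences of a reflection among s_1 .. s_j .. s_1 is an invariant of the group
  element, which gives the exchange condition.  An element with two left descents s, t
  then has a reduced expression starting with the alternating word of length m_st, as
  soon as the order of st in W is at least m_st; the latter is read off the geometric
  representation in its dual form, the numbers game, over the algebraic numbers.
*)
Require Import Defs.
From mathcomp Require Import all_boot all_algebra all_field boolp ring.
Set Implicit Arguments. Unset Strict Implicit. Unset Printing Implicit Defensive.

(** * Commutation classes, with one marked letter followed through the swaps *)

Lemma cat_eq_split (T : Type) (u v z1 z2 : seq T) (a : T) :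
  u ++ v = z1 ++ a :: z2 ->
  (exists2 u', u = z1 ++ a :: u' & z2 = u' ++ v) \/
  (exists2 v', z1 = u ++ v' & v = v' ++ a :: z2).
Proof.
elim: u z1 => [|b u IHu] z1 /=; first by move=> ->; right; exists z1.
case: z1 => [|c z1] /= [-> uv]; first by left; exists u.
by case: (IHu _ uv) => [[u' -> ->]|[v' -> ->]]; [left; exists u'|right; exists v'].
Qed.

Section CommutationClasses.
Variables (S : finType) (m : S -> S -> nat).
Hypothesis mC : forall s t, m s t = m t s.
Implicit Types (u v w z : seq S) (s t a b : S).

Lemma comm_eq_trans u v w : comm_eq m u v -> comm_eq m v w -> comm_eq m u w.
Proof. by elim=> // {}u u' {}v uu' _ IH /IH; apply: comm_trans. Qed.

Lemma comm_step_eq u v : comm_step m u v -> comm_eq m u v.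
Proof. by move/comm_trans; apply; apply: comm_refl. Qed.

Lemma comm_eq_sym u v : comm_eq m u v -> comm_eq m v u.
Proof.
elim=> [w|{}u u' {}v uu' _ IH]; first exact: comm_refl.
apply: comm_eq_trans IH _; apply: comm_step_eq.
by case: uu' => x y s t mst; apply: comm_swap; rewrite mC.
Qed.

Lemma comm_eq_cat x y u v : comm_eq m u v -> comm_eq m (x ++ u ++ y) (x ++ v ++ y).
Proof.
elim=> [w|{}u u' {}v uu' _ IH]; first exact: comm_refl.
apply: comm_eq_trans IH; apply: comm_step_eq; case: uu' => u1 v1 s t mst.
by rewrite -!catA ![x ++ u1 ++ _]catA; apply: comm_swap.
Qed.

Lemma comm_eq_cons s u v : comm_eq m u v -> comm_eq m (s :: u) (s :: v).
Proof. by move/(comm_eq_cat [:: s] [::]); rewrite !cats0. Qed.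

Lemma comm_eq_catl x u v : comm_eq m u v -> comm_eq m (x ++ u) (x ++ v).
Proof. by move/(comm_eq_cat x [::]); rewrite !cats0. Qed.

Lemma comm_eq_catr y u v : comm_eq m u v -> comm_eq m (u ++ y) (v ++ y).
Proof. exact: (comm_eq_cat [::] y). Qed.

Lemma comm_eq_size u v : comm_eq m u v -> size u = size v.
Proof. by elim=> // {}u u' {}v [x y s t _] _ <-; rewrite !size_cat. Qed.

(** A swap exchanges commuting letters, so it never reorders an [s] with a [t]; this invariant later
    separates commutation classes. *)
Lemma comm_eq_filter s t u v : m s t != 2 ->
  comm_eq m u v -> filter (pred2 s t) u = filter (pred2 s t) v.
Proof.
move=> mst; elim=> // {}u u' {}v [x y a b mab] _ <-; rewrite !filter_cat /=.
have [as_|_] := boolP ((a == s) || (a == t)); have [bs_|_] := boolP ((b == s) || (b == t)) => //=.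
case/pred2P: as_ mab => ->; case/pred2P: bs_ => -> //; last rewrite mC;
  by move/eqP; rewrite (negPf mst).
Qed.

Definition commutes a w := all (fun b => m a b == 2) w.

Lemma comm_eq_move a w : commutes a w -> comm_eq m (a :: w) (rcons w a).
Proof.
elim: w => [|b w IHw] /=; first by move=> _; apply: comm_refl.
case/andP=> /eqP mab cw; apply: (@comm_trans _ _ _ (b :: a :: w)).
  exact: (@comm_swap _ m [::] w).
exact/comm_eq_cons/IHw.
Qed.

(** One occurrence of [a] is followed through the swaps. A letter can only pass it by commuting with
    it, so everything to its right keeps commuting with it, and erasing it turns each swap into a
    swap or an identity. *)
Lemma comm_eq_commuting_letter x y z1 z2 a :
    comm_eq m x y -> x = z1 ++ a :: z2 -> commutes a z2 ->
  exists y1 y2, [/\ y = y1 ++ a :: y2, commutes a y2 &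
                    comm_eq m (z1 ++ z2) (y1 ++ y2)].
Proof.
move=> xy; elim: xy z1 z2 => [w|{}x x' {}y xx' _ IH] z1 z2 def_x caz2.
  by exists z1, z2; split=> //; apply: comm_refl.
suff [y1 [y2 [def_x' cay2 zy]]] : exists y1 y2, [/\ x' = y1 ++ a :: y2,
    commutes a y2 & comm_eq m (z1 ++ z2) (y1 ++ y2)].
  have [y1' [y2' [-> cay2' yy']]] := IH _ _ def_x' cay2.
  by exists y1', y2'; split=> //; apply: comm_eq_trans yy'.
case: xx' def_x {IH} => u v s t mst def_x.
have [[u' -> ez2]|[v' ->]] := cat_eq_split def_x.
  move: caz2; rewrite {}ez2 /commutes !all_cat /= => /and3P[cu' /and3P[cs ct _] cv].
  exists z1, (u' ++ [:: t; s] ++ v); split; first by rewrite -catA.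
    by rewrite /commutes !all_cat /= cu' ct cs cv.
  by apply: comm_step_eq; rewrite !(catA z1); apply: comm_swap.
(* The marked [a] is the first letter of the swapped pair, the second one, or lies to the right of
   the pair. *)
move: caz2; case: v' => [|b [|c v']] /= caz2 [].
- move=> sa ez2; move: caz2; rewrite -{}ez2 -{}sa cats0 /= => /andP[_ cav].
  exists (u ++ [:: t]), v; split=> //; first by rewrite -catA.
  by rewrite -catA; apply: comm_refl.
- move=> <- ta ->; move: caz2; rewrite -{}ta => ctz2.
  exists u, (s :: z2); split=> //=; first by rewrite mC mst.
  by rewrite -catA; apply: comm_refl.
- move=> <- <- ->; exists (u ++ [:: t, s & v']), z2; split=> //.
    by rewrite -catA.
  by rewrite -!catA; apply: comm_step_eq; apply: comm_swap.
Qed.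

Lemma comm_eq_rcons w a z : comm_eq m (rcons w a) z ->
  exists z1 z2, [/\ z = z1 ++ a :: z2, commutes a z2 & comm_eq m w (z1 ++ z2)].
Proof.
move=> wz; have def_wa : rcons w a = w ++ a :: [::] by rewrite cats1.
have [z1 [z2 [-> caz2 ww]]] := comm_eq_commuting_letter wz def_wa isT.
by exists z1, z2; rewrite cats0 in ww.
Qed.

Lemma comm_eq_insert w a z1 z2 : commutes a z2 -> comm_eq m w (z1 ++ z2) ->
  comm_eq m (rcons w a) (z1 ++ a :: z2).
Proof.
move=> caz2 /(comm_eq_catr [:: a]); rewrite !cats1 => /comm_eq_trans; apply.
rewrite -cats1 -catA cats1; apply: comm_eq_catl.
exact/comm_eq_sym/comm_eq_move.
Qed.

(** * A finite automaton reading off factors up to commutation *)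

Section FactorAutomaton.
Variable N : nat.

Definition factor_state : finType := {set N.-bseq S * {set S}}.

Definition factors w : factor_state :=
  [set x : N.-bseq S * {set S} | `[< exists u v, comm_eq m w (u ++ x.1 ++ v) /\
                                                [set b in v] = x.2 >] ].

(** From the old pair [x] to the new pair [y]: the letter [a] stays within the right part [v], or it
    passes all of the old [v] and then either enters [q] or passes [q] too and lands in [u]. *)
Definition factor_trans a (x y : N.-bseq S * {set S}) : Prop :=
  (y.1 = x.1 /\ y.2 = a |: x.2) \/
  [/\ forall b, b \in y.2 -> m a b = 2, y.2 = x.2 &
   (exists q1 q2, [/\ y.1 = q1 ++ a :: q2 :> seq S, x.1 = q1 ++ q2 :> seq S
                    & commutes a q2])
   \/ (y.1 = x.1 /\ commutes a y.1)].

Definition factor_delta (A : factor_state) a : factor_state :=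
  [set y | `[< exists2 x : N.-bseq S * {set S}, x \in A & factor_trans a x y >] ].

Lemma commutesP a v : reflect (forall b, b \in [set c in v] -> m a b = 2) (commutes a v).
Proof.
apply: (iffP allP) => cav b; first by rewrite inE => /cav/eqP.
by move=> bv; apply/eqP/cav; rewrite inE.
Qed.

Lemma factors_rcons w a : factors (rcons w a) = factor_delta (factors w) a.
Proof.
apply/setP=> -[q V]; rewrite !inE; apply/asboolP/asboolP => /=; last first.
  case=> -[p U]; rewrite !inE => /asboolP[u [v [/= wupv <-]]].
  case=> [/= [-> ->]|/= [caV eV]].
    exists u, (rcons v a); split.
      by rewrite -!rcons_cat -!cats1; apply: comm_eq_catr.
    by apply/setP=> b; rewrite !inE mem_rcons inE.
  move: caV; rewrite {}eV => /commutesP cav [[q1 [q2 [-> p12 caq2]]]|[-> caq]].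
    rewrite p12 in wupv; exists u, v; split=> //.
    have -> : u ++ (q1 ++ a :: q2) ++ v = (u ++ q1) ++ a :: (q2 ++ v).
      by rewrite -!catA.
    apply: comm_eq_insert; last by rewrite -!catA in wupv *.
    by rewrite /commutes all_cat; apply/andP.
  exists (rcons u a), v; split=> //; rewrite cat_rcons.
  by apply: comm_eq_insert wupv; rewrite /commutes all_cat; apply/andP.
case=> u [v [/comm_eq_rcons[z1 [z2 []]]]].
move=> def_z caz2 wz <- {V}.
(* The final [a] sits in [u], in [q] or in [v]; erasing it gives the decomposition of [w] from which
   the transition starts. *)
have [[u' _ ez2]|[v' ez1 def_v]] := cat_eq_split def_z.
  exists (q, [set b in v]).
    by rewrite inE; apply/asboolP; exists (z1 ++ u'), v; rewrite -catA -ez2.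
  move: caz2; rewrite ez2 /commutes !all_cat => /and3P[_ caq cav].
  by right; split=> //=; [apply/commutesP|right].
have [[q2 eq ez2]|[v1 ev' ev]] := cat_eq_split def_v.
  move: caz2; rewrite ez2 /commutes all_cat => /andP[caq2 cav].
  have szp : size (v' ++ q2) <= N.
    by apply: leq_trans (size_bseq q); rewrite eq !size_cat /= leq_add2l.
  exists (Bseq szp, [set b in v]).
    by rewrite inE; apply/asboolP; exists u, v; rewrite /= -catA -ez2 catA -ez1.
  right; split=> //=; first exact/commutesP.
  by left; exists v', q2.
exists (q, [set b in v1 ++ z2]).
  by rewrite inE; apply/asboolP; exists u, (v1 ++ z2); split=> //=;
     rewrite ez1 ev' -!catA in wz.
left; split=> //=; apply/setP=> b; rewrite ev !(inE, mem_cat).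
by case: (b == a); rewrite ?orbT.
Qed.

(** By the length bound every word satisfying [P] fits in [N.-bseq S], so its presence shows in the
    state. Acceptance looks at the factors; the letter sets serve the transitions. *)
Lemma avoiding_factors_regular (P : pred (seq S)) :
    (forall q, P q -> size q <= N) ->
  regular_language (fun w => forall u q v, comm_eq m w (u ++ q ++ v) -> ~~ P q).
Proof.
move=> PN; exists factor_state, (factors [::]), factor_delta.
exists (fun A : factor_state => [forall x in A, ~~ P (val x.1)]) => w.
have -> : foldl factor_delta (factors [::]) w = factors w.
  by elim/last_ind: w => //= w a IHw; rewrite foldl_rcons IHw factors_rcons.
split=> [avoids|/forall_inP avoids u q v wuqv].
  apply/forall_inP=> -[q V]; rewrite inE => /asboolP[u [v [wuqv _]]].
  exact: avoids wuqv.
apply/negP=> Pq; have qN := PN q Pq.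
have /avoids/negP : (Bseq qN, [set b in v]) \in factors w.
  by rewrite inE; apply/asboolP; exists u, v.
exact.
Qed.

End FactorAutomaton.
End CommutationClasses.

(** * Alternating words and powers of st *)

Section AlternatingWords.
Variable S : eqType.
Implicit Types (s t : S) (n k : nat).

Fixpoint alt s t n : seq S := if n is n'.+1 then s :: alt t s n' else [::].

Lemma size_alt s t n : size (alt s t n) = n.
Proof. by elim: n s t => //= n IHn s t; rewrite IHn. Qed.

Lemma take_alt s t n k : k <= n -> take k (alt s t n) = alt s t k.
Proof. by elim: n s t k => [|n IHn] s t [|k] //= le_kn; rewrite IHn. Qed.

(** [relator] with a free exponent: [relator m s t] is convertible to [relpow s t (m s t)]. *)
Definition relpow s t n := flatten (nseq n [:: s; t]).

Lemma relpowS s t n : relpow s t n.+1 = [:: s, t & relpow s t n].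
Proof. by []. Qed.

Lemma relpowD s t n k : relpow s t (n + k) = relpow s t n ++ relpow s t k.
Proof. by rewrite /relpow nseqD flatten_cat. Qed.

Lemma relpow_rcons s t n : relpow s t n ++ [:: s] = s :: relpow t s n.
Proof. by elim: n => //= n IHn; rewrite relpowS /= IHn. Qed.

Lemma rev_relpow s t n : rev (relpow s t n) = relpow t s n.
Proof.
elim: n => // n IHn; rewrite relpowS !rev_cons -!cats1 IHn.
by rewrite relpow_rcons /= relpow_rcons.
Qed.

Lemma alt_rev_alt s t n : alt s t n ++ rev (alt t s n) = relpow s t n.
Proof.
elim: n s t => // n IHn s t; rewrite /= rev_cons -cats1 catA IHn.
by rewrite relpow_rcons.
Qed.

End AlternatingWords.

(** * The group W as a congruence on words *)

Section CoxeterCongruence.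
Variables (S : finType) (m : S -> S -> nat).
Hypothesis mss : forall s, m s s = 1.
Implicit Types (u v w x y z r : seq S) (s t a b : S).

Notation "u =W v" := (cox_eq m u v) (at level 70).

Lemma cox_eq_trans v u w : u =W v -> v =W w -> u =W w.
Proof. by elim=> // {}u u' {}v uu' _ IH /IH; apply: cox_trans. Qed.

Lemma cox_step_eq u v : cox_step m u v -> u =W v.
Proof. by move/cox_trans; apply; apply: cox_refl. Qed.

Lemma cox_eq_sym u v : u =W v -> v =W u.
Proof.
elim=> [w|{}u u' {}v uu' _ IH]; first exact: cox_refl.
apply: cox_eq_trans IH _; apply: cox_step_eq.
by case: uu' => x y s t mst; constructor.
Qed.

Lemma cox_eq_cat2 x y u v : u =W v -> (x ++ u ++ y) =W (x ++ v ++ y).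
Proof.
elim=> [w|{}u u' {}v uu' _ IH]; first exact: cox_refl.
apply: cox_eq_trans IH; apply: cox_step_eq.
by case: uu' => u1 v1 s t mst; rewrite -!catA ![x ++ u1 ++ _]catA; constructor.
Qed.

Lemma cox_eq_cat u u' v v' : u =W u' -> v =W v' -> (u ++ v) =W (u' ++ v').
Proof.
move=> /(cox_eq_cat2 [::] v) /= uu' /(cox_eq_cat2 u' [::]).
by rewrite !cats0; apply: cox_eq_trans.
Qed.

Lemma cox_eq_cons s u v : u =W v -> (s :: u) =W (s :: v).
Proof. exact: (cox_eq_cat (cox_refl m [:: s])). Qed.

Lemma relpow_eq1 s t : 0 < m s t -> relpow s t (m s t) =W [::].
Proof.
move=> m_gt0; apply: cox_step_eq.
by have := @cox_del _ m [::] [::] s t m_gt0; rewrite /= cats0.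
Qed.

Lemma letter_invol s w : [:: s, s & w] =W w.
Proof.
have := @cox_del _ m [::] w s s; rewrite /relator mss => /(_ isT).
exact: cox_step_eq.
Qed.

(** Letters are involutions, so [rev] represents inversion in W. *)
Lemma cat_rev_eq1 w : (w ++ rev w) =W [::].
Proof.
elim/last_ind: w => [|w s IHw]; first exact: cox_refl.
rewrite rev_rcons cat_rcons; apply: cox_eq_trans IHw.
exact: cox_eq_cat (cox_refl _ _) (letter_invol _ _).
Qed.

Lemma rev_cat_eq1 w : (rev w ++ w) =W [::].
Proof. by have := cat_rev_eq1 (rev w); rewrite revK. Qed.

Lemma cox_eq_cancell w u v : (w ++ u) =W (w ++ v) -> u =W v.
Proof.
move/(cox_eq_cat (cox_refl m (rev w))); rewrite !catA => wuv.
apply: cox_eq_trans (cox_eq_sym (cox_eq_cat (rev_cat_eq1 w) (cox_refl _ u))) _.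
exact: cox_eq_trans wuv (cox_eq_cat (rev_cat_eq1 w) (cox_refl _ v)).
Qed.

Lemma cox_eq_cons_cancel s u v : (s :: u) =W (s :: v) -> u =W v.
Proof. exact: (@cox_eq_cancell [:: s]). Qed.

Lemma cox_eq_rev u v : u =W v -> rev u =W rev v.
Proof.
move=> uv; apply: (@cox_eq_cancell u).
apply: cox_eq_trans (cat_rev_eq1 u) _; apply: cox_eq_trans (cox_eq_sym (cat_rev_eq1 v)) _.
by apply: cox_eq_cat (cox_eq_sym uv) (cox_refl _ _).
Qed.

(** Whatever the parity of [n], one alternating word times the inverse of the other is (st)^n. *)
Lemma alt_eq_relpow s t n : alt s t n =W alt t s n <-> relpow s t n =W [::].
Proof.
rewrite -alt_rev_alt; split=> [st|].
  by apply: cox_eq_trans (cat_rev_eq1 (alt t s n)); apply: cox_eq_cat (cox_refl _ _).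
move/cox_eq_cat/(_ (cox_refl m (alt t s n))) => /= st; apply: cox_eq_trans st.
rewrite -catA -{1}[alt s t n]cats0; apply: cox_eq_cat (cox_refl _ _) _.
exact/cox_eq_sym/rev_cat_eq1.
Qed.

Lemma braid_eq s t : 0 < m s t -> alt s t (m s t) =W alt t s (m s t).
Proof. by move=> m_gt0; apply/alt_eq_relpow/relpow_eq1. Qed.

Lemma comm_eq_cox_eq u v : comm_eq m u v -> u =W v.
Proof.
elim=> [w|{}u u' {}v uu' _ IH]; first exact: cox_refl.
apply: cox_eq_trans IH; case: uu' => x y s t mst; apply: cox_eq_cat2.
by have := @braid_eq s t; rewrite mst; apply.
Qed.

(** * Reflections of a word and the parity of their multiplicities *)

(* The j-th entry is the reflection s_1 .. s_j .. s_1 attached to the j-th letter. *)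
Fixpoint reflections w : seq (seq S) :=
  if w is s :: w' then [:: s] :: [seq s :: r ++ [:: s] | r <- reflections w']
  else [::].

Definition conj u r := u ++ r ++ rev u.

Lemma conj_nil r : conj [::] r = r.
Proof. exact: cats0. Qed.

Lemma conj_cat u v r : conj (u ++ v) r = conj u (conj v r).
Proof. by rewrite /conj rev_cat -!catA. Qed.

Lemma cox_eq_conj u v r : u =W v -> conj u r =W conj v r.
Proof.
move=> uv; apply: cox_eq_cat (uv) _; apply: cox_eq_cat (cox_refl _ _) _.
exact: cox_eq_rev.
Qed.

Lemma reflections_cat u v :
  reflections (u ++ v) = reflections u ++ map (conj u) (reflections v).
Proof.
elim: u => [|s u IHu] /=.
  by rewrite -[LHS]map_id; apply: eq_map => r; rewrite /conj cats0.
rewrite IHu map_cat -map_comp; congr (_ :: _ ++ _); apply: eq_map => r /=.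
by rewrite -[in RHS]cat1s conj_cat.
Qed.

Lemma reflectionsP w r : r \in reflections w ->
  exists u a v, w = u ++ a :: v /\ r = conj u [:: a].
Proof.
elim: w r => //= s w IHw r; rewrite inE => /orP[/eqP->|/mapP[r' /IHw]].
  by exists [::], s, w.
move=> [u [a [v [-> ->]]]] ->; exists (s :: u), a, v; split=> //.
by rewrite -[in RHS]cat1s conj_cat.
Qed.

Lemma reflections_relpow s t k :
  reflections (relpow s t k) = mkseq (fun j => relpow s t j ++ [:: s]) k.*2.
Proof.
elim: k => // k IHk; rewrite -addn1 relpowD reflections_cat IHk addn1.
rewrite doubleS !mkseqS -!cats1 -catA; congr (_ ++ _) => /=.
rewrite /conj rev_relpow /= -!relpow_rcons -addnn.
rewrite -[[:: s, t & flatten _ ++ _]]/(relpow s t (k + k).+1 ++ [:: s]).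
by rewrite -addnS !relpowD -!catA.
Qed.

Definition refl_count w x := count (fun r => `[< r =W x >]) (reflections w).

Lemma eq_refl_pred u v x : u =W v -> `[< u =W x >] = `[< v =W x >].
Proof.
move=> uv; apply: asbool_equiv_eq; split; apply: cox_eq_trans => //.
exact: cox_eq_sym.
Qed.

Lemma conj_eqE u r x : `[< conj u r =W x >] = `[< r =W conj (rev u) x >].
Proof.
have conjK v y z : conj v y =W z -> y =W conj (rev v) z.
  move=> yz; apply: (@cox_eq_cancell v).
  rewrite /conj revK; apply: (cox_eq_trans (v := v ++ y ++ rev v ++ v)).
    rewrite -{1}[v ++ y]cats0 -catA; apply: cox_eq_cat (cox_refl _ _) _.
    by apply: cox_eq_cat (cox_refl _ _) (cox_eq_sym (rev_cat_eq1 v)).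
  apply: (cox_eq_trans (v := z ++ v)).
    by rewrite !catA; apply: cox_eq_cat (cox_refl _ _); rewrite -catA.
  rewrite catA -{1}[z ++ v]cat0s; apply: cox_eq_cat (cox_refl _ _).
  exact/cox_eq_sym/cat_rev_eq1.
apply: asbool_equiv_eq; split=> [/conjK //|/cox_eq_sym/conjK].
by rewrite revK; apply: cox_eq_sym.
Qed.

(** Cocycle identity: behind the prefix [u] the reflections of [v] appear conjugated by [u], and the
    conjugation is moved over to [x]. *)
Lemma refl_count_cat u v x :
  refl_count (u ++ v) x = refl_count u x + refl_count v (conj (rev u) x).
Proof.
rewrite /refl_count reflections_cat count_cat count_map; congr (_ + _).
by apply: eq_count => r /=; rewrite conj_eqE.
Qed.

(* Since (st)^m = 1, the 2m reflections (st)^j s of the word (st)^m repeat with period m. *)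
Lemma odd_refl_count_relator s t x : 0 < m s t -> ~~ odd (refl_count (relator m s t) x).
Proof.
move=> m_gt0; rewrite /refl_count reflections_relpow -addnn /mkseq iotaD map_cat.
rewrite count_cat -[0 + m s t]addn0 iotaDl -map_comp !count_map.
set c := count _ _; set c' := count _ _; suff -> : c' = c by rewrite addnn odd_double.
apply: eq_count => j /=; apply: eq_refl_pred; rewrite relpowD.
apply: cox_eq_cat (cox_refl _ _); rewrite -[relpow s t j]cat0s catA cats0.
exact: cox_eq_cat (relpow_eq1 m_gt0) (cox_refl _ _).
Qed.

Lemma eq_refl_count w x y : x =W y -> refl_count w x = refl_count w y.
Proof.
move=> xy; apply: eq_count => r; apply: asbool_equiv_eq.
by split=> rx; apply: cox_eq_trans rx _ => //; apply: cox_eq_sym.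
Qed.

Lemma odd_refl_count_insert u v s t x : 0 < m s t ->
  odd (refl_count (u ++ relator m s t ++ v) x) = odd (refl_count (u ++ v) x).
Proof.
move=> m_gt0; rewrite !refl_count_cat !oddD (negPf (odd_refl_count_relator _ m_gt0)) /=.
(* The relator is trivial in W, so conjugating [x] by it does not affect the count in [v]. *)
congr (_ (+) odd _); rewrite -{2}[conj (rev u) x]conj_nil.
apply/eq_refl_count/cox_eq_conj.
exact: (cox_eq_rev (relpow_eq1 m_gt0)).
Qed.

Lemma odd_refl_count u v x : u =W v -> odd (refl_count u x) = odd (refl_count v x).
Proof.
elim=> // {}u u' {}v [y z s t m_gt0|y z s t m_gt0] _ <-;
  by rewrite odd_refl_count_insert.
Qed.

(** Conjugation by [s] fixes [s], so only the new first letter adds to the count: the parity at [s]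
    differs between [w] and [s w]. *)
Lemma refl_count_cons s w : refl_count (s :: w) [:: s] = (refl_count w [:: s]).+1.
Proof.
rewrite -cat1s refl_count_cat /= /refl_count /=.
have -> : `[< [:: s] =W [:: s] >] by apply/asboolP/cox_refl.
by rewrite addn0 add1n; congr _.+1; apply/eq_refl_count/letter_invol.
Qed.

(** * Reduced words and the exchange condition *)

Lemma exists_reduced w : exists2 v, w =W v & reduced m v.
Proof.
pose P n := `[< exists2 v, w =W v & size v = n >].
have exP : exists n, P n by exists (size w); apply/asboolP; exists w => //; apply: cox_refl.
case: (ex_minnP exP) => n /asboolP[v wv <-] min_v; exists v => // v' vv'.
by apply: min_v; apply/asboolP; exists v' => //; apply: cox_eq_trans vv'.
Qed.

Lemma reduced_eq u v : reduced m u -> u =W v -> size v = size u -> reduced m v.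
Proof. by move=> ru uv suv w vw; rewrite suv; apply/ru/(cox_eq_trans uv). Qed.

Lemma reduced_size u v : reduced m u -> reduced m v -> u =W v -> size u = size v.
Proof. by move=> ru rv uv; apply/eqP; rewrite eqn_leq ru ?rv //; apply: cox_eq_sym. Qed.

Lemma reduced_behead s w : reduced m (s :: w) -> reduced m w.
Proof. by move=> rsw v wv; apply: (rsw (s :: v)); apply: cox_eq_cons. Qed.

(** An odd count is positive, so [s] equals some reflection u a u^-1 of the word. *)
Lemma refl_count_exchange s w : odd (refl_count w [:: s]) ->
  exists u a v, w = u ++ a :: v /\ (s :: u) =W (u ++ [:: a]).
Proof.
move/odd_gt0; rewrite -has_count => /hasP[r /reflectionsP].
move=> [u [a [v [-> ->]]]] /asboolP uas; exists u, a, v; split=> //.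
apply: cox_eq_sym; apply: cox_eq_trans _ (cox_eq_cat uas (cox_refl _ u)).
rewrite /conj -{1}[u ++ [:: a]]cats0 -!catA.
apply: cox_eq_cat (cox_refl _ _) _; apply: cox_eq_cat (cox_refl _ _) _.
exact/cox_eq_sym/rev_cat_eq1.
Qed.

Lemma exchange s w : reduced m w -> ~ reduced m (s :: w) ->
  exists u a v, w = u ++ a :: v /\ (s :: u) =W (u ++ [:: a]).
Proof.
move=> rw nrsw; case: (boolP (odd (refl_count w [:: s]))) => [|even_w].
  exact: refl_count_exchange.
(* With an even count in [w], the count is odd in a reduced word [w'] of [s w]. Exchange in [w']
   then writes [w] with one letter less than [w'], so [s w] is no longer than [w']. *)
case: nrsw; have [w' sww' rw'] := exists_reduced (s :: w).
have /refl_count_exchange[u [a [v [def_w' sua]]]] : odd (refl_count w' [:: s]).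
  by rewrite -(odd_refl_count _ sww') refl_count_cons.
have wuv : w =W (u ++ v).
  apply: cox_eq_trans (cox_eq_sym (letter_invol s w)) _.
  apply: cox_eq_trans (cox_eq_cons s sww') _; rewrite def_w' -cat_cons.
  apply: cox_eq_trans (cox_eq_cat sua (cox_refl _ _)) _; rewrite -catA.
  exact: cox_eq_cat (cox_refl _ _) (letter_invol _ _).
apply: (reduced_eq rw' (cox_eq_sym sww')); apply/eqP; rewrite eqn_leq.
rewrite (rw' (s :: w)) ?andbT; last exact: cox_eq_sym.
by rewrite def_w' size_cat /= addnS ltnS -size_cat; apply: rw.
Qed.

End CoxeterCongruence.

(** * The numbers game and the order of st *)

Section NumbersGame.
Import GRing.Theory.
Local Open Scope ring_scope.
Variables (S : finType) (m : S -> S -> nat).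
Hypothesis mC : forall s t, m s t = m t s.
Hypothesis mss : forall s, m s s = 1%N.
Hypothesis mst : forall s t, s != t -> m s t != 1%N.

(** The default 1 at 0 gives an infinite bond the label 2. *)
Definition root2 n : algC :=
  if n is n'.+1 then sval (C_prim_root_exists (isT : (0 < n'.+1.*2)%N)) else 1.

Lemma root2P n : (0 < n)%N -> n.*2.-primitive_root (root2 n).
Proof. by case: n => // n _; rewrite /root2; case: C_prim_root_exists. Qed.

Lemma root2_neq0 n : root2 n != 0.
Proof.
case: n => [|n]; first exact: oner_neq0.
by rewrite (prim_root_eq0 (root2P _)) // doubleS.
Qed.

(* 2 cos (pi / m_st) up to the choice of the primitive root, hence -2 for s = t and 2 for
   m_st = infinity. *)
Definition edge s t : algC := root2 (m s t) + (root2 (m s t))^-1.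

(** The reflection [s] acting on linear forms, [f u] being the value on the simple root of [u]. *)
Definition fire s (f : S -> algC) : S -> algC := fun u => f u + edge s u * f s.

Definition game w f := foldl (fun f s => fire s f) f w.

Lemma edge_diag s : edge s s = - 2.
Proof.
rewrite /edge mss; have r2 := root2P (isT : (0 < 1)%N).
have : root2 1 ^+ 2 == 1 by rewrite (prim_expr_order r2).
rewrite sqrf_eq1 => /orP[/eqP r1|/eqP->]; last by rewrite invrN1; ring.
by have := prim_order_dvd r2 1; rewrite r1 expr1n eqxx.
Qed.

Lemma edgeC s t : edge s t = edge t s.
Proof. by rewrite /edge mC. Qed.

Lemma eq_game w f g : f =1 g -> game w f =1 game w g.
Proof. by elim: w f g => //= s w IHw f g fg; apply: IHw => u; rewrite /fire !fg. Qed.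

Lemma game_cat u v f : game (u ++ v) f = game v (game u f).
Proof. exact: foldl_cat. Qed.

Lemma fireK s f : fire s (fire s f) =1 f.
Proof. by move=> u; rewrite /fire edge_diag; ring. Qed.

Lemma fire2 s t f : s != t -> let g := fire t (fire s f) in
  let y := f t + edge s t * f s in
  [/\ g s = - f s + edge s t * y, g t = - y
    & forall u, g u = f u + edge s u * f s + edge t u * y].
Proof. by move=> st; rewrite /fire !edge_diag (edgeC t s); split=> [||u]; ring. Qed.

Lemma sum_powersS (z : algC) k :
  \sum_(i < k.+1) z ^+ i = 1 + z * \sum_(i < k) z ^+ i.
Proof.
by rewrite big_ord_recl mulr_sumr expr0; congr (_ + _); apply: eq_bigr => i _;
   rewrite -exprS.
Qed.

(* Two consecutive firings turn f s = A + B into A r^2 + B r^-2, r being a root of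
   r + 1/r = edge s t. *)
Lemma game_relpow s t f (A B : algC) k : s != t -> let r := root2 (m s t) in
    f s = A + B -> f t = - (A * r^-1 + B * r) ->
  game (relpow s t k) f s = A * r ^+ k.*2 + B * r^-1 ^+ k.*2 /\
  forall u, game (relpow s t k) f u = f u
    + (edge s u + edge t u * r) * A * (\sum_(i < k) (r ^+ 2) ^+ i)
    + (edge s u + edge t u * r^-1) * B * (\sum_(i < k) (r^-1 ^+ 2) ^+ i).
Proof.
move=> st r; have r0 : r != 0 := root2_neq0 _.
elim: k f A B => [|k IHk] f A B fs ft.
  by rewrite !big_ord0 /= !expr0; split=> [|u]; [rewrite fs|]; ring.
rewrite relpowS /=; have [gs gt gu] := fire2 f st.
have [||-> gk] := IHk (fire t (fire s f)) (A * r ^+ 2) (B * r^-1 ^+ 2).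
- by rewrite gs ft fs /edge -/r; field.
- by rewrite gt ft fs /edge -/r; field.
split=> [|u]; first by rewrite doubleS !exprS; ring.
rewrite gk gu !sum_powersS ft fs [edge s t]/edge -/r.
by set X := \sum_(i < k) _; set Y := \sum_(i < k) _; field.
Qed.

Lemma sum_root_powers n (z : algC) : z != 1 -> z ^+ n = 1 -> \sum_(i < n) z ^+ i = 0.
Proof.
move=> z1 zn; apply/eqP; have := subrX1 z n; rewrite zn subrr => /esym/eqP.
by rewrite mulf_eq0 subr_eq0 (negPf z1).
Qed.

(** For distinct [s] and [t], r^2 is an m_st-th root of unity other than 1, so both geometric sums
    vanish over a full period. *)
Lemma game_relator s t f : (0 < m s t)%N -> game (relpow s t (m s t)) f =1 f.
Proof.
move=> m_gt0; have [<-|st] := eqVneq s t; first by rewrite mss; apply: fireK.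
have m_gt1 : (1 < m s t)%N by rewrite ltn_neqAle eq_sym mst.
have rP := root2P m_gt0; set r := root2 _ in rP.
have r0 : r != 0 := root2_neq0 _.
have r21 : r ^+ 2 != 1.
  rewrite -(prim_order_dvd rP); apply/negP=> /(dvdn_leq (isT : (0 < 2)%N)).
  by rewrite -[2%N]/(1%N.*2) leq_double leqNgt m_gt1.
(* The solution of f s = A + B and f t = - (A/r + B r), where r differs from 1/r. *)
pose A := (f t + r * f s) / (r - r^-1).
have [||_ gu] := @game_relpow s t f A (f s - A) (m s t) st.
- by ring.
- by rewrite /A -/r; field; rewrite r0 -expr2 subr_eq0.
move=> u; rewrite gu -/r sum_root_powers ?sum_root_powers ?mulr0 ?addr0 //.
- by rewrite exprVn invr_eq1.
- by rewrite -exprM mul2n exprVn (prim_expr_order rP) invr1.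
- by rewrite -exprM mul2n (prim_expr_order rP).
Qed.

Lemma game_cox_eq u v : cox_eq m u v -> forall f, game u f =1 game v f.
Proof.
elim=> // {}u u' {}v [x y s t m_gt0|x y s t m_gt0] _ IH f w; rewrite -IH !game_cat;
  by apply: eq_game => a; rewrite (game_relator _ m_gt0).
Qed.

Lemma relpow_eq1_order s t k : s != t -> (0 < k)%N ->
  cox_eq m (relpow s t k) [::] -> (0 < m s t <= k)%N.
Proof.
move=> st k_gt0 /game_cox_eq game1; have [m0|m_gt0] := posnP (m s t).
  (* Infinite bond: from 0 at [s] and 1 at [t], each st adds 2 to the value at [s], which never
     returns to 0. *)
  have {}game1 := game1 (fun u => if u == s then 0 else 1) s.
  have game_s i f (d : nat) : f s = d.*2%:R -> f t = 1 - d.*2%:R ->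
      game (relpow s t i) f s = (d + i).*2%:R.
    elim: i f d => [|i IHi] f d fs ft; first by rewrite addn0.
    rewrite addnS -addSn; apply: IHi; have [gs gt _] := fire2 f st.
      by rewrite gs ft fs /edge m0 /= invr1 doubleS -[d.*2.+2]addn2 natrD; ring.
    by rewrite gt ft fs /edge m0 /= invr1 doubleS -[d.*2.+2]addn2 natrD; ring.
  have := game_s k (fun u => if u == s then 0 else 1) 0%N; rewrite game1 /= eqxx.
  rewrite eq_sym (negPf st) subr0 => /(_ erefl erefl)/esym/eqP.
  by rewrite Num.Theory.pnatr_eq0 double_eq0 gtn_eqF.
rewrite /=; set r := root2 (m s t).
(* The eigenvector A = 1, B = 0: its value at [s] after (st)^k is r^(2k), which is 1 only if m_st
   divides k. *)
pose f u := if u == s then 1 else - r^-1.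
have [||gs _] := @game_relpow s t f 1 0 k st; rewrite /f ?eqxx ?addr0 //.
  by rewrite eq_sym (negPf st) mul1r mul0r addr0.
have := game1 f s; rewrite gs mul1r mul0r addr0 /= /f eqxx => /eqP.
rewrite -(prim_order_dvd (root2P m_gt0)) => /dvdn_leq; rewrite double_gt0 => /(_ k_gt0).
by rewrite leq_double.
Qed.

End NumbersGame.

(** * Two descents and Stembridge's criterion *)

Section FullyCommutative.
Variables (S : finType) (m : S -> S -> nat).
Hypothesis mC : forall s t, m s t = m t s.
Hypothesis mss : forall s, m s s = 1.
Hypothesis mst : forall s t, s != t -> m s t != 1.
Implicit Types (u v w : seq S) (s t : S).

Notation "u =W v" := (cox_eq m u v) (at level 70).
Let Wrefl := cox_refl m.
Let Wtrans := @cox_eq_trans S m.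
Let Wsym := @cox_eq_sym S m.

(** As [q] is a left descent, exchange applies to [q w]. A letter exchanged inside the alternating
    prefix would make the order of pq at most [k]; so it lies in [c], and the prefix grows by a [q]
    in front. *)
Lemma two_descents_step (p q : S) k c b w : p != q ->
    m p q = 0 \/ k < m p q -> reduced m w -> reduced m (q :: b) ->
    w =W (q :: b) -> (alt p q k ++ c) =W w -> size (alt p q k ++ c) = size w ->
  exists2 c', (alt q p k.+1 ++ c') =W w & size (alt q p k.+1 ++ c') = size w.
Proof.
move=> pq mk rw rqb wqb cw szc.
have rc : reduced m (alt p q k ++ c) by apply: reduced_eq rw (Wsym cw) szc.
have nrqc : ~ reduced m (q :: alt p q k ++ c).
  move=> /(_ b); rewrite /= szc (reduced_size rw rqb wqb) /= ltnNge leqnSn => H.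
  suff /H : (q :: alt p q k ++ c) =W b by [].
  apply: Wtrans (letter_invol mss q b); apply: cox_eq_cons.
  exact: Wtrans cw wqb.
have [u [a [v [def_c qua]]]] := exchange mss rc nrqc.
have [[u' alt_u _]|[c1 def_u def_v]] := cat_eq_split def_c.
  have uk : size u < k.
    by have := congr1 size alt_u; rewrite size_alt size_cat /= => ->; rewrite addnS ltnS leq_addr.
  have alt_u1 : u ++ [:: a] = alt p q (size u).+1.
    by rewrite -(take_alt p q uk) alt_u take_cat ltnNge leqnSn subSnn /= take0.
  have u_alt : u = alt p q (size u).
    by rewrite -(take_alt p q (ltnW uk)) alt_u take_size_cat.
  (* Here q u = u a equates the two alternating words of length [(size u).+1], which is at most
     [k]. *)
  have : relpow p q (size u).+1 =W [::].
    by apply/(alt_eq_relpow mss); rewrite -alt_u1 /= -u_alt; apply: Wsym.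
  move/(relpow_eq1_order mC mss mst pq (ltn0Sn _))/andP=> [m_gt0 le_m].
  case: mk => [m0|lt_km]; first by rewrite m0 in m_gt0.
  by have := leq_trans (leq_trans lt_km le_m) uk; rewrite ltnn.
exists (c1 ++ v); last first.
  by rewrite -szc /= def_v !size_cat /= !size_alt !addnS.
rewrite /= catA -def_u; apply: Wtrans cw; rewrite def_c.
by rewrite -cat_cons -[a :: v]cat1s [X in _ =W X]catA; apply: cox_eq_cat.
Qed.

(** Each step changes the first letter of the prefix, so which of [s], [t] comes first is left
    open. *)
Lemma two_descents_alt s t a b w k : s != t -> reduced m w ->
    reduced m (t :: b) -> w =W (s :: a) -> w =W (t :: b) ->
    reduced m (s :: a) -> 0 < k -> m s t = 0 \/ k <= m s t ->
  exists p q c, [/\ (p, q) = (s, t) \/ (p, q) = (t, s),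
    (alt p q k ++ c) =W w & size (alt p q k ++ c) = size w].
Proof.
move=> st rw rtb wsa wtb rsa; case: k => // k _.
elim: k => [|k IHk] mk.
  exists s, t, a; split; [by left|exact: Wsym|by rewrite (reduced_size rw rsa wsa)].
have [|p [q [c [pq cw szc]]]] := IHk _; first by case: mk => [->|/ltnW]; [left|right].
have [b' [npq mpq rb' wb']] : exists b', [/\ p != q, m p q = 0 \/ k.+1 < m p q,
    reduced m (q :: b') & w =W (q :: b')].
  by case: pq => -[-> ->]; [exists b|exists a; rewrite eq_sym mC].
have [c' c'w szc'] := two_descents_step npq mpq rw rb' wb' cw szc.
by exists q, p, c'; split=> //; case: pq => -[-> ->]; [right|left].
Qed.

Lemma two_descents_braid s t a b w : s != t -> reduced m w ->
    reduced m (s :: a) -> reduced m (t :: b) ->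
    w =W (s :: a) -> w =W (t :: b) ->
  0 < m s t /\ exists2 c, (alt s t (m s t) ++ c) =W w
                        & size (alt s t (m s t) ++ c) = size w.
Proof.
move=> st rw rsa rtb wsa wtb.
have m_gt0 : 0 < m s t.
  (* With an infinite bond the alternating prefix could be made longer than [w]. *)
  rewrite lt0n; apply/negP=> /eqP m0.
  have [p [q [c [_ _ szc]]]] :=
    two_descents_alt st rw rtb wsa wtb rsa (ltn0Sn (size w)) (or_introl m0).
  by move/eqP: szc; rewrite size_cat size_alt addSn gtn_eqF // ltnS leq_addr.
split=> //; have [p [q [c [pq cw szc]]]] :=
  two_descents_alt st rw rtb wsa wtb rsa m_gt0 (or_intror (leqnn _)).
exists c; last by rewrite -szc !size_cat !size_alt.
(* If the prefix starts with [t], the braid relation puts [s] first. *)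
case: pq cw => -[-> ->] // cw; apply: Wtrans cw; apply: cox_eq_cat (Wrefl _).
exact: braid_eq.
Qed.

(** The test [2 < m s t] leaves out commuting pairs and also infinite bonds, encoded by 0. *)
Definition forbidden (q : seq S) := [exists s, exists t,
  (q == [:: s; s]) || (2 < m s t) && (q == alt s t (m s t))].

Definition avoids w := forall u q v, comm_eq m w (u ++ q ++ v) -> ~~ forbidden q.

Lemma forbidden_square s : forbidden [:: s; s].
Proof. by apply/existsP; exists s; apply/existsP; exists s; rewrite eqxx. Qed.

Lemma forbidden_alt s t : 2 < m s t -> forbidden (alt s t (m s t)).
Proof. by move=> m3; apply/existsP; exists s; apply/existsP; exists t; rewrite m3 eqxx orbT. Qed.

Lemma avoids_comm_eq w w' : comm_eq m w w' -> avoids w -> avoids w'.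
Proof. by move=> ww' aw u q v w'q; apply: (aw u q v); apply: comm_eq_trans w'q. Qed.

Lemma avoids_behead s w : avoids (s :: w) -> avoids w.
Proof. by move=> aw u q v /(comm_eq_cons s)/(aw (s :: u)). Qed.

(** A square could be cancelled, against reducedness; braiding an alternating factor would give a
    reduced word in another commutation class. *)
Lemma FC_avoids w : FC_reduced_word m w -> avoids w.
Proof.
move=> [rw FCw] u q v wuqv; apply/negP=> /existsP[s /existsP[t]].
have wW := comm_eq_cox_eq mss wuqv.
case/orP=> [/eqP q_ss|/andP[m3 /eqP q_alt]].
  have := rw (u ++ v); rewrite (comm_eq_size wuqv) q_ss !size_cat /= !addnS.
  rewrite ltnNge leqnSn => H; suff /H : w =W (u ++ v) by [].
  apply: Wtrans wW _; rewrite q_ss; apply: cox_eq_cat (Wrefl _) _.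
  exact: (letter_invol mss s v).
have m_gt0 : 0 < m s t by apply: leq_trans m3.
have wW' : w =W (u ++ alt t s (m s t) ++ v).
  by apply: Wtrans wW _; rewrite q_alt; apply/cox_eq_cat2/braid_eq.
have szw' : size (u ++ alt t s (m s t) ++ v) = size w.
  by rewrite (comm_eq_size wuqv) q_alt !size_cat !size_alt.
have := FCw _ wW' (reduced_eq rw wW' szw').
move/(comm_eq_trans (comm_eq_sym mC wuqv)); rewrite q_alt.
(* Restricted to the letters [s] and [t], the two words differ at the start of the braided
   factor. *)
move/(comm_eq_filter mC (s := s) (t := t)) => /(_ (negbT (gtn_eqF m3))).
have alt_st x y n : (x == s) || (x == t) -> (y == s) || (y == t) ->
    filter (pred2 s t) (alt x y n) = alt x y n.
  by move=> xst yst; elim: n x y xst yst => //= n IHn x y xst yst; rewrite xst IHn.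
rewrite !filter_cat !alt_st ?eqxx ?orbT // => /eqP.
rewrite eqseq_cat // eqxx /= eqseq_cat ?size_alt // => /andP[+ _].
case def_m: (m s t) m3 => [|[|n]] //= _; rewrite !eqseq_cons => /andP[/eqP st _].
by rewrite st mss in def_m.
Qed.

Lemma avoids_FC w : avoids w -> FC_reduced_word m w.
Proof.
have [n] := ubnP (size w); elim: n w => // n IHn [|s a] /= lt_wn aw.
  have r0 : reduced m [::] by [].
  split=> // w' w'0 /reduced_size/(_ r0 (Wsym w'0))/eqP.
  by rewrite size_eq0 => /eqP->; apply: comm_refl.
have [ra FCa] := IHn a lt_wn (avoids_behead aw).
have rsa : reduced m (s :: a).
  (* Otherwise exchange gives a reduced word of [a] starting with [s]; it is commutation equivalent
     to [a], so the square [s s] appears. *)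
  apply: contrapT => nrsa; have [u [b [v [def_a sub]]]] := exchange mss ra nrsa.
  have asuv : a =W (s :: u ++ v).
    apply: Wtrans (Wsym (letter_invol mss s a)) _; apply: cox_eq_cons.
    rewrite def_a -cat_cons; apply: Wtrans (cox_eq_cat sub (Wrefl _)) _.
    by rewrite -catA; apply: cox_eq_cat (Wrefl _) (letter_invol mss b v).
  have rsuv : reduced m (s :: u ++ v).
    by apply: reduced_eq ra asuv _; rewrite def_a /= !size_cat /= addnS.
  have /(comm_eq_cons s)/(aw [::] [:: s; s] (u ++ v)) := FCa _ asuv rsuv.
  by rewrite forbidden_square.
split=> // -[|t b] sa_tb rtb; first by have := reduced_size rsa rtb sa_tb.
have [st|st] := eqVneq s t.
  rewrite -st in sa_tb rtb *; apply/comm_eq_cons/FCa.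
    exact: cox_eq_cons_cancel sa_tb.
  exact: reduced_behead rtb.
have [m_gt0 [c cw szc]] := two_descents_braid st rsa rsa rtb (Wrefl _) sa_tb.
have rc : reduced m (alt s t (m s t) ++ c) by apply: reduced_eq rsa (Wsym cw) szc.
have [k mk] : exists k, m s t = k.+2.
  by have := mst st; case: (m s t) m_gt0 => [|[|k]] // _ _; exists k.
have wc : comm_eq m (s :: a) (alt s t (m s t) ++ c).
  rewrite mk /= in cw rc *; apply/comm_eq_cons/FCa; last exact: reduced_behead rc.
  exact: cox_eq_cons_cancel (Wsym cw).
(* For m_st at least 3 the braid prefix is forbidden; there remains m_st = 2. *)
case: k mk => [|k] mk; last first.
  have := aw [::] _ c wc; rewrite forbidden_alt //; by rewrite mk.
rewrite mk /= in cw szc rc wc.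
have wtsc : comm_eq m (s :: a) [:: t, s & c].
  by apply: comm_eq_trans wc (comm_step_eq (@comm_swap _ m [::] c s t mk)).
have sa_tsc := comm_eq_cox_eq mss wtsc.
(* The word [s :: c] has the length of [a], and it represents the same element as [b]. *)
have [|rsc FCsc] := IHn (s :: c) _ (avoids_behead (avoids_comm_eq wtsc aw)).
  by case: szc => /= ->.
apply: comm_eq_trans wtsc _; apply/comm_eq_cons/FCsc; last exact: reduced_behead rtb.
exact: cox_eq_cons_cancel (Wtrans (Wsym sa_tsc) sa_tb).
Qed.

End FullyCommutative.

Theorem theorem3p5 (S : finType) (m : S -> S -> nat) :
  coxeter_matrix m -> regular_language (FC_reduced_word m).
Proof.
(* The summand 2 makes room for the squares, the rest for the alternating words. *)
move=> [mC mss mst]; pose N := \max_s \max_t (m s t).+2.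
have [|Q [q0 [delta [acc accP]]]] := @avoiding_factors_regular S m mC N (forbidden m).
  move=> q /existsP[s /existsP[t st_q]].
  apply: leq_trans (leq_bigmax s); apply: leq_trans (leq_bigmax t).
  by case/orP: st_q => [/eqP->|/andP[_ /eqP->]] //; rewrite size_alt -addn2 leq_addr.
exists Q, q0, delta, acc => w; split=> [/(FC_avoids mC mss)/accP //|/accP].
exact: avoids_FC.
Qed.
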